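(* If there exists a mixed Steiner system $\mathrm{MS}(3,4,\mathbb{Z}_2^n\times\mathbb{Z}_q)$, then $n\ge q+1$, and moreover at least one of the following holds: $6$ divides $n-1$ and $q$ is even; or $n\equiv 3\pmod{12}$ and $q\equiv 2\pmod{12}$; or $n\equiv 9\pmod{12}$ and $q\equiv 2\pmod 6$.
   Context: For integers $q_1,\dots,q_N\ge 2$, $Q=\mathbb{Z}_{q_1}\times\cdots\times\mathbb{Z}_{q_N}$ is viewed as the set of words of length $N$ whose $i$-th letter lies in $\mathbb{Z}_{q_i}$; $\mathbb{Z}_2^n\times\mathbb{Z}_q$ has $n\ge1$ binary coordinates and one coordinate over $\mathbb{Z}_q$, $q\ge 2$. The weight of a word is its number of nonzero coordinates, and $d(\cdot,\cdot)$ is the Hamming distance. For integers $1\le t\le k\le N$, a mixed Steiner system $\mathrm{MS}(t,k,Q)$ is a set $\mathcal{C}$ of words of $Q$ of weight $k$ such that (i) for every word $x\in Q$ of weight $t$ there is exactly one $c\in\mathcal{C}$ with $d(x,c)=k-t$; and (ii) any two distinct elements of $\mathcal{C}$ are at Hamming distance at least $2(k-t)+1$. *)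

(* Defs.v *)
From mathcomp Require Import all_boot all_algebra.
Set Implicit Arguments.
Unset Strict Implicit.
Unset Printing Implicit Defensive.

(* 'Z_m is the ring of integers modulo m only when m >= 2, so every entry of
   the alphabet vector q is meant to be at least 2. *)
Definition word (N : nat) (q : 'I_N -> nat) : predArgType :=
  {dffun forall i : 'I_N, 'Z_(q i)}.

Definition weight (N : nat) (q : 'I_N -> nat) (x : word q) : nat :=
  #|[set i : 'I_N | x i != 0%R]|.

Definition hdist (N : nat) (q : 'I_N -> nat) (x y : word q) : nat :=
  #|[set i : 'I_N | x i != y i]|.

(* The range condition on t and k is part of the notion: for t > N the empty
   set would satisfy the other clauses vacuously. *)
Definition mixed_steiner (N t k : nat) (q : 'I_N -> nat)
    (C : {set word q}) : Prop :=
  [/\ [&& 1 <= t, t <= k & k <= N],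
      forall c : word q, c \in C -> weight c = k,
      forall x : word q, weight x = t ->
        exists! c : word q, c \in C /\ hdist x c = k - t
    & forall c c' : word q, c \in C -> c' \in C -> c != c' ->
        2 * (k - t) + 1 <= hdist c c'].

(* Alphabet sizes of Z_2^n x Z_q; the coordinate over Z_q is the last one. *)
Definition binary_plus_one (n q : nat) (i : 'I_n.+1) : nat :=
  if i == ord_max then q else 2.

(* Main.v *)
Require Import Defs.
From mathcomp Require Import all_boot all_algebra.
From mathcomp Require Import zify.

(* Identify a word of Z_2^n x Z_q with a pair (A, k), A a subset of an n-set and
   k < q its last letter.  For k <> 0 the code words ending in k are the blocks
   of a Steiner triple system, and these q - 1 systems are pairwise disjoint; a
   triple in none of them lies in exactly one of the quadruples ending in 0.
   Counting blocks through a set of size 0, 1 or 2 gives, with n = 2r + 1 and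
   b2, b1, b0 the numbers of quadruples through a pair, a point and in total,
   3 | nr,  2r = 2 b2 + q,  2 r b2 = 3 b1  and  n r b2 = 6 b0,
   whence the inequality and the congruences. *)

(** * Double counting of blocks through a set *)

Section DoubleCounting.

Variable V : finType.
Implicit Types (S T A P : {set V}) (B : {set {set V}}).

(** Adding [S] maps the [t]-subsets of [A :\: S] bijectively onto these sets. *)
Lemma card_subsets_between S A t :
  S \subset A ->
  #|[set T : {set V} | [&& S \subset T, T \subset A & #|T| == #|S| + t]]|
    = 'C(#|A| - #|S|, t).
Proof.
move=> sSA; have -> : #|A| - #|S| = #|A :\: S| by rewrite cardsD (setIidPr sSA).
pose X := [set U : {set V} | U \subset A :\: S & #|U| == t].
have injU : {in X &, injective (setU S)}.
  move=> U W; rewrite !inE !subsetD.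
  move=> /andP[/andP[_ dU] _] /andP[/andP[_ dW] _] eUW.
  have: (S :|: U) :\: S = (S :|: W) :\: S by rewrite eUW.
  by rewrite !setDUl !setDv !set0U (setDidPl dU) (setDidPl dW).
rewrite -cards_draws -/X -(card_in_imset injU).
congr #|pred_of_set _|; apply/setP=> T; rewrite inE; apply/and3P/imsetP.
  case=> sST sTA /eqP cT; exists (T :\: S).
    by rewrite inE setSD //= cardsD (setIidPr sST) cT addKn.
  by rewrite -[LHS](setID T S) (setIidPr sST).
case=> U; rewrite inE subsetD => /andP[/andP[sUA dU] /eqP cU] ->.
split; rewrite ?subsetUl // ?subUset ?sSA //.
by rewrite cardsU setIC (disjoint_setI0 dU) cards0 subn0 cU.
Qed.

(** Both sides count the pairs [S \subset T \subset A] with [A] a block: by [T] on the left, by [A]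
    on the right. *)
Lemma sum_blocks_containing B k S t :
  (forall A, A \in B -> #|A| = k) ->
  \sum_(T : {set V} | (S \subset T) && (#|T| == #|S| + t))
      #|[set A in B | T \subset A]|
    = #|[set A in B | S \subset A]| * 'C(k - #|S|, t).
Proof.
move=> cB; under eq_bigr => T _ do rewrite -sum1_card big_mkcond /=.
rewrite exchange_big /= -sum_nat_const big_mkcond [RHS]big_mkcond /=.
apply: eq_bigr => A _; rewrite -big_mkcondr inE.
case: (boolP (A \in B)) => [AB|nAB] /=; last first.
  by rewrite big_pred0 // => T; rewrite inE (negbTE nAB) andbF.
case: (boolP (S \subset A)) => [sSA|nSA]; last first.
  rewrite big_pred0 // => T; rewrite inE AB /=; apply/negP.
  by case/andP=> /andP[sST _] sTA; rewrite (subset_trans sST sTA) in nSA.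
rewrite -(cB A AB) -(card_subsets_between S A t sSA) -[RHS]sum1_card.
by apply: eq_bigl => T; rewrite !inE AB /= -andbA [_ && (T \subset A)]andbC.
Qed.

Lemma card_supersets S t :
  #|[set T : {set V} | (S \subset T) && (#|T| == #|S| + t)]|
    = 'C(#|V| - #|S|, t).
Proof.
rewrite -cardsT -(card_subsets_between S setT t (subsetT S)).
by apply: eq_card => T; rewrite !inE subsetT.
Qed.

(** * Block counts for triple systems completed by quadruples *)

Section Blocks.

Variables (m : nat) (D : 'I_m -> {set {set V}}) (B : {set {set V}}).
Hypothesis cardD : forall a T, T \in D a -> #|T| = 3.
Hypothesis cardB : forall A, A \in B -> #|A| = 4.
Hypothesis coverD : forall a P,
  #|P| = 2 -> #|[set T in D a | P \subset T]| = 1.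
(** The sum 1 says at once that no triple is in two of the systems and that the triples in none of
    them are those lying in a quadruple, each in exactly one. *)
Hypothesis coverB : forall T, #|T| = 3 ->
  #|[set A in B | T \subset A]| + #|[set a | T \in D a]| = 1.

(** Sum [coverD] over the pairs that contain [S]. *)
Lemma triple_system_count a S t : #|S| + t = 2 ->
  'C(#|V| - #|S|, t) = #|[set T in D a | S \subset T]| * 'C(3 - #|S|, t).
Proof.
move=> cS; rewrite -(sum_blocks_containing _ _ _ _ (cardD a)).
rewrite -card_supersets -[LHS]sum1_card.
apply: eq_big => T; rewrite inE // => /andP[_ /eqP cT].
by rewrite coverD // cT.
Qed.

(** Sum [coverB] over the triples that contain [S]; exchanging sums counts the second term system by
    system. *)
Lemma quadruple_count S t : #|S| + t = 3 ->
  'C(#|V| - #|S|, t) = #|[set A in B | S \subset A]| * 'C(4 - #|S|, t)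
    + \sum_a #|[set T in D a | S \subset T]|.
Proof.
move=> cS; rewrite -(sum_blocks_containing _ _ _ _ cardB).
have -> : \sum_a #|[set T in D a | S \subset T]| =
    \sum_(T : {set V} | (S \subset T) && (#|T| == #|S| + t))
      #|[set a | T \in D a]|.
  under [RHS]eq_bigr => T _ do rewrite -sum1_card big_mkcond /=.
  rewrite exchange_big /=; apply: eq_bigr => a _.
  rewrite -big_mkcondr -[LHS]sum1_card; apply: eq_bigl => T; rewrite !inE.
  case: (boolP (T \in D a)) => [Ta|]; rewrite ?andbF //=.
  by rewrite (cardD a T Ta) cS eqxx !andbT.
rewrite -big_split /= -card_supersets -[LHS]sum1_card.
apply: eq_big => T; rewrite inE // => /andP[_ /eqP cT].
by rewrite coverB // cT.
Qed.

(** The witness [r] is the number of triples through a point in one of the systems. *)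
Lemma block_counts : 0 < m -> 2 < #|V| ->
  exists r b0 b1 b2, [/\ #|V| = 2 * r + 1, 3 %| (2 * r + 1) * r,
    2 * r = 2 * b2 + m + 1, r * 2 * b2 = 3 * b1
    & (2 * r + 1) * r * b2 = 6 * b0].
Proof.
move=> m_gt0 V_gt2; pose a0 := Ordinal m_gt0.
have [T] : exists T : {set V}, T \in [set T : {set V} | #|T| == 2].
  by apply/card_gt0P; rewrite card_draws bin_gt0 ltnW.
rewrite inE => /eqP cT.
have /card_gt0P[x _] : 0 < #|T| by rewrite cT.
have e2 := quadruple_count T 1; have e1 := quadruple_count [set x] 2.
have e0 := quadruple_count set0 3.
have d1 a := triple_system_count a [set x] 1.
have d0 a := triple_system_count a set0 2.
have E4 : 'C(4, 3) = 4 by []. have E3 : 'C(3, 2) = 3 by [].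
rewrite ?cards1 ?cards0 ?cT ?subn0 ?bin1 ?subn1 /= ?E4 ?E3 in e2 e1 e0 d1 d0.
have {}e2 := e2 erefl; have {}e1 := e1 erefl; have {}e0 := e0 erefl.
have {}d1 a := d1 a erefl; have {}d0 a := d0 a erefl.
rewrite (eq_bigr (fun=> 1)) ?sum1_card ?card_ord in e2; last first.
  by move=> a _; exact: coverD.
pose d a := #|[set T0 in D a | [set x] \subset T0]|.
pose g a := #|[set T0 in D a | set0 \subset T0]|.
(* By [d1] all systems have equally many triples through [x], so the sum is [m] times one term;
   likewise below for the total number of triples. *)
rewrite (eq_bigr (fun=> d a0)) ?sum_nat_const ?card_ord in e1; last first.
  move=> a _; rewrite -/(d a); have := d1 a; have := d1 a0.
  by rewrite -!/(d _); lia.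
rewrite (eq_bigr (fun=> g a0)) ?sum_nat_const ?card_ord in e0; last first.
  move=> a _; rewrite -/(g a); have := d0 a; have := d0 a0.
  by rewrite -!/(g _); lia.
have := d1 a0; have := d0 a0; rewrite -/(d a0) -/(g a0).
move: (g a0) (d a0) e0 e1 => e r e0 e1 Ee Er {d g d0 d1}.
move: #|V| V_gt2 e0 e1 e2 Ee Er => N N_gt2 e0 e1 e2 Ee Er.
exists r, #|[set A in B | set0 \subset A]|, #|[set A in B | [set x] \subset A]|.
exists #|[set A in B | T \subset A]|.
move: #|[set A in B | set0 \subset A]| #|[set A in B | [set x] \subset A]|
  #|[set A in B | T \subset A]| e0 e1 e2 => b0 b1 b2 e0 e1 e2.
have eN : N = 2 * r + 1 by lia.
have e2r : 2 * r = 2 * b2 + m + 1 by lia.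
(* Absorption turns the binomials in the counts into products. *)
have f2 := mul_bin_diag N 1; have f3 := mul_bin_diag N 2.
have g2 := mul_bin_diag N.-1 1.
have eN' : N.-1 = 2 * r by lia.
have eN'' : N.-1.-1 = 2 * b2 + m by lia.
rewrite !bin1 eN'' e1 Ee e0 eN' eN in f2 f3 g2.
split=> //.
(* Each of the [N] points is on [r] of the [e] triples of a system, so [N * r = 3 * e]. *)
- by apply/dvdnP; exists e; nia.
(* In both remaining equations the terms with [m] cancel. *)
- nia.
- nia.
Qed.

End Blocks.

End DoubleCounting.

(** * Congruences forced by the block counts *)

Lemma block_counts_congruences n q r b0 b1 b2 :
  0 < q ->
  n = 2 * r + 1 -> 3 %| (2 * r + 1) * r -> 2 * r = 2 * b2 + q ->
  r * 2 * b2 = 3 * b1 -> (2 * r + 1) * r * b2 = 6 * b0 ->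
  q + 1 <= n /\
  [\/ 6 %| n - 1 /\ ~~ odd q,
      n = 3 %[mod 12] /\ q = 2 %[mod 12]
    | n = 9 %[mod 12] /\ q = 2 %[mod 6]].
Proof.
move=> q_gt0 -> d3 eq2 eq1 eq0; split; first by lia.
have oq : ~~ odd q by lia.
case: (boolP (3 %| r)) => [r3|r3]; first by apply: Or31; lia.
(* Hence [r] is 1 modulo 3; once 3 divides [b2], [q = 2 * r - 2 * b2] is 2 modulo 6, and the parity
   of [r] fixes [n] modulo 12. *)
have n3 : 3 %| 2 * r + 1 by move: d3; rewrite Euclid_dvdM // (negbTE r3) orbF.
have b3 : 3 %| b2.
  have: 3 %| r * 2 * b2 by rewrite eq1 dvdn_mulr.
  by rewrite !Euclid_dvdM // (negbTE r3).
case: (boolP (odd r)) => ro; last by apply: Or33; lia.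
(* For odd [r] this makes [2 * b2] divisible by 12, which lifts the congruence of [q] to modulus
   12. *)
have b2e : ~~ odd b2.
  have: ~~ odd ((2 * r + 1) * r * b2) by rewrite eq0 oddM.
  by rewrite !oddM oddD oddM ro.
by apply: Or32; lia.
Qed.

(** * Words as pairs of a subset and a last letter *)

Section Words.

Variables n q : nat.
Hypothesis q_ge2 : 2 <= q.
Implicit Types (A P : {set 'I_n}) (j k : nat).

(* [inZp] reduces k modulo q, so the last letter is k only for k < q. *)
Definition word_of A k : word (@binary_plus_one n q) :=
  finfun (fun i =>
    inZp (if unlift ord_max i is Some x then (x \in A : nat) else k)).

Lemma word_of_lift A k (x : 'I_n) :
  word_of A k (lift ord_max x) = (x \in A) :> nat.
Proof.
have qx : @binary_plus_one n q (lift ord_max x) = 2.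
  by rewrite /binary_plus_one eq_sym (negbTE (neq_lift _ _)).
by rewrite ffunE liftK /= Zp_cast qx // modn_small //; case: (x \in A).
Qed.

Lemma word_of_last A k : k < q -> word_of A k ord_max = k :> nat.
Proof.
move=> k_lt; rewrite ffunE unlift_none /=.
by rewrite /binary_plus_one eqxx Zp_cast // modn_small.
Qed.

Lemma hdist_word_of A A' k k' : k < q -> k' < q ->
  hdist (word_of A k) (word_of A' k') = #|A :\: A'| + #|A' :\: A| + (k != k').
Proof.
move=> k_lt k'_lt; rewrite /hdist -sum1_card big_mkcond big_ord_recr /=.
congr (_ + _).
  rewrite -!sum1_card [in RHS]big_mkcond [X in _ + X]big_mkcond -big_split.
  apply: eq_bigr => x _; rewrite !inE.
  have -> : widen_ord (leqnSn n) x = lift ord_max x.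
    by apply: val_inj; rewrite /= /bump leqNgt ltn_ord.
  by rewrite -val_eqE /= !word_of_lift; do 2!case: (_ \in _).
by rewrite inE -val_eqE /= !word_of_last //; case: eqP.
Qed.

Lemma weight_word_of A k : k < q -> weight (word_of A k) = #|A| + (k != 0).
Proof.
move=> k_lt.
have -> : weight (word_of A k) = hdist (word_of A k) (word_of set0 0).
  apply: eq_card => i; rewrite !inE.
  suff -> : word_of set0 0 i = 0%R by [].
  apply: val_inj; rewrite ffunE.
  by case: unliftP => [x|] _; rewrite /= ?inE mod0n.
by rewrite hdist_word_of ?(ltnW q_ge2) // setD0 set0D cards0 addn0.
Qed.

Lemma word_of_surj (c : word (@binary_plus_one n q)) :
  exists A k, k < q /\ c = word_of A k.
Proof.
exists [set x | c (lift ord_max x) != 0%R], (val (c ord_max)).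
have lastq : @binary_plus_one n q ord_max = q by rewrite /binary_plus_one eqxx.
have k_lt : val (c ord_max) < q.
  by apply: leq_trans (ltn_ord (c ord_max)) _; rewrite Zp_cast lastq.
split=> //; apply/ffunP => i; apply: val_inj.
case: (unliftP ord_max i) => [x ->|->]; last by rewrite /= word_of_last.
rewrite /= word_of_lift inE -val_eqE /=.
have : c (lift ord_max x) < 2.
  apply: leq_trans (ltn_ord (c (lift ord_max x))) _.
  by rewrite /binary_plus_one eq_sym (negbTE (neq_lift _ _)).
by case: (nat_of_ord _) => [|[]].
Qed.

Lemma word_of_inj A A' k k' : k < q -> k' < q ->
  word_of A k = word_of A' k' -> A = A' /\ k = k'.
Proof.
move=> k_lt k'_lt e; split; last by rewrite -(word_of_last A k) // e word_of_last.
apply/setP => x; have := word_of_lift A k x; rewrite e word_of_lift.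
by do 2!case: (x \in _).
Qed.

(** The weights differ by one, so distance 1 means that one zero letter becomes nonzero: a point
    joins [P] if [j = k], or the last letter changes from 0 to [k]. *)
Lemma hdist_word_of_eq1 A P j k : j < q -> k < q ->
  weight (word_of P j) = 3 -> weight (word_of A k) = 4 ->
  (hdist (word_of P j) (word_of A k) == 1) =
    (P \subset A) && ((j == 0) || (j == k)).
Proof.
move=> j_lt k_lt; rewrite hdist_word_of // !weight_word_of // => wP wA.
rewrite -setD_eq0 -cards_eq0.
have := cardsID A P; have := cardsID P A; rewrite setIC.
by move: #|_ :&: _| #|P :\: A| #|A :\: P| #|P| #|A| wP wA => a b c d e; lia.
Qed.

(** * Layers of a mixed Steiner system *)

Section Code.

Variable C : {set word (@binary_plus_one n q)}.
Hypothesis C_ms : mixed_steiner 3 4 C.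

(** For [0 < k < q] this is a Steiner triple system; [layer 0] consists of the quadruples. *)
Definition layer k : {set {set 'I_n}} := [set A | word_of A k \in C].

Lemma card_layer A k : k < q -> A \in layer k -> #|A| + (k != 0) = 4.
Proof.
by case: C_ms => _ wC _ _ k_lt; rewrite inE => /wC; rewrite weight_word_of.
Qed.

(** This is the covering condition at the word [(P, j)] of weight 3: [j = 0] leaves the layer free,
    a nonzero [j] prescribes it. *)
Lemma layer_cover P j : j < q -> #|P| + (j != 0) = 3 ->
  exists A k, [/\ k < q, A \in layer k, P \subset A, j = 0 \/ j = k
    & forall A' k', k' < q -> A' \in layer k' -> P \subset A' ->
        j = 0 \/ j = k' -> A' = A /\ k' = k].
Proof.
case: C_ms => _ wC covC _ j_lt cP.
have wP : weight (word_of P j) = 3 by rewrite weight_word_of.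
have hd A k : k < q -> A \in layer k ->
    hdist (word_of P j) (word_of A k) = 4 - 3 <->
      P \subset A /\ (j = 0 \/ j = k).
  move=> k_lt AC; have wA : weight (word_of A k) = 4.
    by rewrite weight_word_of // card_layer.
  rewrite (rwP eqP) hdist_word_of_eq1 //; split.
    by case/andP=> -> /orP[] /eqP; split; auto.
  by case=> -> [] ->; rewrite eqxx ?orbT.
have [c [[cC dc] uc]] := covC _ wP; have [A [k [k_lt ec]]] := word_of_surj c.
subst c; have AC : A \in layer k by rewrite inE.
have [PA jk] := proj1 (hd A k k_lt AC) dc.
exists A, k; split=> // A' k' k'_lt A'C PA' jk'.
apply: word_of_inj => //; symmetry; apply: uc; split; first by rewrite inE in A'C.
by apply/hd.
Qed.

Lemma card_layer_pair P k : 0 < k < q -> #|P| = 2 ->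
  #|[set T in layer k | P \subset T]| = 1.
Proof.
case/andP=> k_gt0 k_lt cP.
have [|A [k' [k'_lt AC PA [k0|ek] uA]]] := layer_cover P k k_lt.
- by rewrite cP -lt0n k_gt0.
- by rewrite k0 in k_gt0.
subst k'; apply/eqP/cards1P; exists A; apply/setP => T; rewrite !inE.
apply/andP/eqP => [[TC PT]|->]; last by rewrite inE in AC.
by apply: (proj1 (uA T k k_lt _ PT _)); [rewrite inE | right].
Qed.

(** The unique code word near [(P, 0)] ends either in 0, giving a quadruple around [P], or in a
    nonzero letter, and is then [P] itself in that layer. *)
Lemma card_layers_triple P : #|P| = 3 ->
  #|[set A in layer 0 | P \subset A]|
    + #|[set a : 'I_q.-1 | P \in layer a.+1]| = 1.
Proof.
move=> cP; have q_gt0 : 0 < q by exact: ltnW.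
have a_lt (a : 'I_q.-1) : a.+1 < q by have := ltn_ord a; lia.
have [|A [[|k] [k_lt AC PA _ uA]]] := layer_cover P 0 q_gt0.
- by rewrite cP.
- have -> : [set A in layer 0 | P \subset A] = [set A].
    apply/setP => T; rewrite in_set in_set1.
    apply/andP/eqP => [[TC PT]|-> //].
    by apply: (proj1 (uA T 0 q_gt0 TC PT _)); left.
  rewrite cards1 (_ : [set a : 'I__ | _] = set0) ?cards0 //.
  apply/setP => a; rewrite in_set in_set0; apply/negP => Pa.
  by have [] := uA P a.+1 (a_lt a) Pa (subxx P) (or_introl erefl).
have eA : P = A.
  by apply/eqP; rewrite eqEcard PA cP; have := card_layer A k.+1 k_lt AC; lia.
subst A; have -> : [set A in layer 0 | P \subset A] = set0.
  apply/setP => T; rewrite in_set in_set0; apply/negP => /andP[TC PT].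
  by have [] := uA T 0 q_gt0 TC PT (or_introl erefl).
have k_lt' : k < q.-1 by lia.
rewrite cards0 add0n; apply/eqP/cards1P; exists (Ordinal k_lt').
apply/setP => a; rewrite in_set in_set1 -val_eqE /=; apply/idP/eqP => [Pa|-> //].
by have [_ []] := uA P a.+1 (a_lt a) Pa (subxx P) (or_introl erefl).
Qed.

End Code.
End Words.

Theorem theorem4 (n q : nat) (hn : 1 <= n) (hq : 2 <= q)
    (hMS : exists C : {set word (@binary_plus_one n q)}, mixed_steiner 3 4 C) :
  q + 1 <= n /\
  [\/ 6 %| n - 1 /\ ~~ odd q,
      n = 3 %[mod 12] /\ q = 2 %[mod 12]
    | n = 9 %[mod 12] /\ q = 2 %[mod 6]].
Proof.
have [C C_ms] := hMS.
have k_lt (a : 'I_q.-1) : a.+1 < q by have := ltn_ord a; lia.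
(* The shift [a.+1] runs over the [q - 1] nonzero letters, so [m + 1] becomes [q]. *)
have [||||||r [b0 [b1 [b2]]]] := 
  block_counts 'I_n q.-1 (fun a => layer n q C a.+1) (layer n q C 0).
- move=> a T TC.
  by have := card_layer n q hq C C_ms T a.+1 (k_lt a) TC; lia.
- by move=> A AC; have := card_layer n q hq C C_ms A 0 (ltnW hq) AC; lia.
- by move=> a P; apply: (card_layer_pair n q hq C C_ms); exact: k_lt.
- exact: (card_layers_triple n q hq C C_ms).
- by lia.
(* The range clause [4 <= n.+1] gives [2 < n]. *)
- by rewrite card_ord; case: C_ms => /and3P[].
rewrite card_ord => -[en d3 e2 e1 e0].
apply: (block_counts_congruences n q r b0 b1 b2) => //; lia.
Qed.
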